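(* Let $\beta>1$ be a real number such that the beta-shift $S_\beta$ is not sofic. If $F\in\operatorname{Aut}(S_\beta)$ is shiftless, then $F$ admits a blocking word. In particular, every element of $\operatorname{Aut}(S_\beta)$ has an almost equicontinuous direction.
   Context: Notation: $\mathbb{N}=\{0,1,2,\dots\}$; $x[i]$ is the symbol of a sequence $x$ at position $i$, $x[i,j]=x[i]\cdots x[j]$, and $x[i,\infty]=x[i]x[i+1]\cdots$ is regarded as a one-way infinite sequence indexed by $\mathbb{N}$. The shift map is $\sigma(x)[i]=x[i+1]$. A subshift is a nonempty closed set $X\subseteq A^{\mathbb{Z}}$ ($A$ finite) with $\sigma(X)=X$; $L(X)$ is the set of finite words occurring in elements of $X$. Beta-shifts: for real $\beta>1$ let $T_\beta:[0,1]\to[0,1]$, $T_\beta(\xi)=\beta\xi-\lfloor\beta\xi\rfloor$, and let $d(\beta)=d_0d_1d_2\cdots$ be the sequence with $d_i=\lfloor\beta\, T_\beta^{i}(1)\rfloor$ for $i\in\mathbb{N}$. Let $Y_\beta=\{d_0d_1\cdots d_{n-1}b\mid n\in\mathbb{N},\ b\in\mathbb{N},\ 0\le b<d_n\}$. The beta-shift $S_\beta\subseteq\{0,1,\dots,\lfloor\beta\rfloor\}^{\mathbb{Z}}$ is the subshift whose language $L(S_\beta)$ is the set of all subwords of finite concatenations of elements of $Y_\beta$. Cellular automata: a cellular automaton (CA) on $X$ is a continuous map $F:X\to X$ with $F\circ\sigma=\sigma\circ F$; equivalently $F(x)[i]=f(x[i-r],\dots,x[i+r])$ for some $r\ge 0$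 and some local rule $f$, and then $F$ is called a radius-$r$ CA. $\operatorname{Aut}(X)$ is the group of bijective (reversible) CA on $X$. Shiftless: when $S_\beta$ is not sofic and $F$ is a surjective CA on $S_\beta$, there is a unique $i\in\mathbb{Z}$ (the intrinsic shift of $F$) such that for every $x\in S_\beta$ with $x[0,\infty]=d(\beta)$ and every $y\in F^{-1}(x)$ one has $y[i,\infty]=d(\beta)$. $F$ is shiftless if its intrinsic shift is $0$, i.e. $y[0,\infty]=d(\beta)$ for all such $x,y$. Blocking words: for a radius-$r$ CA $F:X\to X$, a word $w\in L(X)$ is a blocking word if there are an integer $e$ with $|w|\ge e\ge r+1$ and an integer $p\in[0,|w|-e]$ such that for all $x,y\in X$ in which $w$ occurs at position $0$ and all $n\in\mathbb{N}$, $F^n(x)[p,p+e-1]=F^n(y)[p,p+e-1]$. A CA on a transitive subshift (beta-shifts are transitive) is almost equicontinuous if and only if it has a blocking word; this may be taken as the definition. Directions: for coprime integers $p,q$ with $q>0$, $p/q$ is an almost equicontinuous direction of $F$ if the CA $\sigma^p\circ F^q$ is almost equicontinuous. *)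

(* Defs.v *)
From HB Require Import structures.
From mathcomp Require Import all_boot all_order all_algebra.
From mathcomp Require Import all_classical all_reals all_analysis.
From mathcomp Require Import zify.
Set Implicit Arguments. Unset Strict Implicit. Unset Printing Implicit Defensive.
Import Order.TTheory GRing.Theory Num.Theory.
Local Open Scope classical_set_scope.
Local Open Scope ring_scope.

(* A^Z with the product of the discrete topologies. *)
Notation conf A := {ptws int -> discrete_topology A}.

Section Subshifts.
Variable A : finType.
Implicit Types (X : set (conf A)) (x y : conf A) (F : conf A -> conf A).

(* [sigma p] is sigma^p, for a possibly negative p. *)
Definition sigma (p : int) x : conf A := fun i => x (i + p).

(* [word x i n] is x[i, i + n - 1]. *)
Definition word x (i : int) (n : nat) : seq A :=
  mkseq (fun k => x (i + k%:Z)) n.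

Definition subshift X := [/\ X !=set0, closed X & sigma 1 @` X = X].

Definition language X : set (seq A) :=
  [set w | exists x i, X x /\ word x i (size w) = w].

(* X is the set of label sequences of the bi-infinite walks on a finite
   directed graph with vertices V, edges E and edge labels in A. *)
Definition sofic X := exists (V E : finType) (src tgt : E -> V) (lab : E -> A),
  X = [set x | exists e : int -> E,
         forall i, tgt (e i) = src (e (i + 1)) /\ lab (e i) = x i].

(* Maps of X are represented by total functions on A^Z whose values outside X
   are irrelevant. *)
Definition CA X F :=
  [/\ set_fun X X F, {within X, continuous F} &
      forall x, X x -> F (sigma 1 x) = sigma 1 (F x)].

(* The argument of f is always the word x[i - r, i + r]. *)
Definition has_radius X (r : nat) F := exists f : seq A -> A,
  forall x, X x -> forall i, F x i = f (word x (i - r%:Z) (r.*2).+1).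

Definition Aut X : set (conf A -> conf A) :=
  [set F | CA X F /\ set_bij X X F].

Definition blocking_word X (r : nat) F (w : seq A) :=
  language X w /\
  exists e p : nat,
    [/\ (r.+1 <= e <= size w)%N, (p <= size w - e)%N &
      forall x y, X x -> X y ->
        word x 0 (size w) = w -> word y 0 (size w) = w ->
        forall n, word (iter n F x) p%:Z e = word (iter n F y) p%:Z e].

(* The radius of a CA is not unique; a blocking word is required to exist
   whichever radius F is given. *)
Definition admits_blocking_word X F :=
  (exists r, has_radius X r F) /\
  forall r, has_radius X r F -> exists w, blocking_word X r F w.

Definition almost_equicontinuous X F := CA X F /\ admits_blocking_word X F.

Definition almost_equicontinuous_direction X F (p : int) (q : nat) :=
  [/\ coprimez p q%:Z, (0 < q)%N &
      almost_equicontinuous X (sigma p \o iter q F)].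

End Subshifts.

Section BetaShift.
Variables (R : realType) (beta : R).

Definition Tbeta (xi : R) : R := beta * xi - (Num.floor (beta * xi))%:~R.

(* The sequence d(beta). *)
Definition dbeta (i : nat) : nat := Num.truncn (beta * iter i Tbeta 1).

Definition Ybeta : set (seq nat) :=
  [set u | exists n b, (b < dbeta n)%N /\ u = rcons (mkseq dbeta n) b].

Definition beta_language : set (seq nat) :=
  [set w | exists us : seq (seq nat),
     (forall u, u \in us -> Ybeta u) /\ infix w (flatten us)].

Definition beta_letter : finType := 'I_(Num.truncn beta).+1.

Definition letters (w : seq beta_letter) : seq nat := map val w.

Definition beta_shift : set (conf beta_letter) :=
  [set x | forall i n, beta_language (letters (word x i n))].

(* x[i, oo] = d(beta) *)
Definition tail_is_dbeta (x : conf beta_letter) (i : int) :=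
  forall k : nat, val (x (i + k%:Z) : beta_letter) = dbeta k.

Definition intrinsic_shift (F : conf beta_letter -> conf beta_letter) (i : int) :=
  forall x, beta_shift x -> tail_is_dbeta x 0 ->
  forall y, beta_shift y -> F y = x -> tail_is_dbeta y i.

Definition shiftless F := intrinsic_shift F 0.

End BetaShift.

Arguments beta_shift {R} beta.
Arguments shiftless {R beta} F.

Section BetaShiftIsSubshift.

Lemma nbhs_word (A : finType) (x : conf A) i n :
  nbhs x [set y : conf A | word y i n = word x i n].
Proof.
elim: n => [|n IHn]; first by apply: filterS filterT => y _.
have Hk : nbhs x [set y : conf A | y (i + n%:Z) = x (i + n%:Z)].
  have := @proj_continuous int (fun=> discrete_topology A) (i + n%:Z) x.
  move=> /(_ [set x (i + n%:Z)]); apply.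
  exact: discrete_set1.
apply: filterS (filterI IHn Hk) => y /= [e1 e2].
by rewrite /word !mkseqS -/(word _ _ _) e1 e2.
Qed.

Lemma size_word (A : finType) (x : conf A) i n : size (word x i n) = n.
Proof. exact: size_mkseq. Qed.

Lemma word_sigma (A : finType) (x : conf A) p i n :
  word (sigma p x) i n = word x (i + p) n.
Proof. by apply: eq_mkseq => k; rewrite /sigma addrAC. Qed.

Lemma sigmaK (A : finType) p : cancel (@sigma A p) (sigma (- p)).
Proof. by move=> x; apply/funext => i; rewrite /sigma subrK. Qed.

Variables (R : realType) (beta : R).
Hypothesis beta_gt1 : 1 < beta.

Let beta_gt0 : 0 < beta. Proof. exact: lt_trans beta_gt1. Qed.

Lemma Tbeta_itv xi : 0 <= Tbeta beta xi < 1.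
Proof.
rewrite /Tbeta subr_ge0 floor_le /= ltrBlDl.
by have := floorD1_gt (beta * xi); rewrite intrD.
Qed.

Lemma iter_Tbeta_itv i : 0 <= iter i (Tbeta beta) 1 <= 1.
Proof.
case: i => [|i]; first by rewrite /= ler01 lexx.
by rewrite iterS; case/andP: (Tbeta_itv (iter i (Tbeta beta) 1)) => -> /ltW ->.
Qed.

Lemma dbeta_le i : (dbeta beta i <= Num.truncn beta)%N.
Proof.
apply: le_truncn; case/andP: (iter_Tbeta_itv i) => _ h.
by rewrite ler_piMr // ltW.
Qed.

Lemma dbeta0_gt0 : (0 < dbeta beta 0)%N.
Proof. by rewrite /dbeta /= mulr1 truncn_gt_nat ltW. Qed.

Lemma Ybeta0 : Ybeta beta [:: 0%N].
Proof. by exists 0%N, 0%N; split=> //; exact: dbeta0_gt0. Qed.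

Lemma Ybeta_le u : Ybeta beta u -> all (fun b => b <= Num.truncn beta)%N u.
Proof.
case=> n [b [ltb ->]]; rewrite all_rcons (leq_trans (ltnW ltb) (dbeta_le n)) /=.
by apply/allP => _ /mapP[k _ ->]; exact: dbeta_le.
Qed.

(* [beta_shift] is indeed the subshift with language [beta_language]. *)
Lemma beta_shiftP :
  subshift (beta_shift beta) /\
  forall w, language (beta_shift beta) w <-> beta_language beta (letters w).
Proof.
have lang w : beta_language beta (letters w) ->
    exists2 x, beta_shift beta x & word x 0 (size w) = w.
  case=> us [Yus /infixP[p [s def]]].
  pose v := flatten us.
  have vle : all (fun b => b <= Num.truncn beta)%N v.
    apply/allP => b /flattenP[u uus bu].
    exact: (allP (Ybeta_le (Yus _ uus))).
  pose g (i : int) : nat :=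
    if i + (size p)%:Z is Posz k then nth 0%N v k else 0%N.
  pose x : conf (beta_letter beta) := fun i => inord (g i).
  have gle i : (g i < (Num.truncn beta).+1)%N.
    rewrite /g; case: (i + _) => // k; rewrite ltnS.
    have [kv|kv] := ltnP k (size v); last by rewrite nth_default.
    by apply: (allP vle); rewrite mem_nth.
  have xE i : val (x i : beta_letter beta) = g i by rewrite /x /= inordK.
  have lx i n : letters (word x i n) = mkseq (fun k => g (i + k%:Z)) n.
    rewrite /letters /word /mkseq -map_comp.
    by apply: eq_map => k; rewrite /= xE.
  exists x; last first.
    apply: (inj_map val_inj); rewrite -/(letters _) lx -/(letters w).
    have -> : letters w = take (size w) (drop (size p) v).
      rewrite /v def drop_size_cat // take_size_cat // size_map //.
    have sw : (size w <= size (drop (size p) v))%N.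
      by rewrite /v def drop_size_cat // size_cat size_map leq_addr.
    apply: (@eq_from_nth _ 0%N).
      by rewrite size_mkseq size_takel.
    move=> k; rewrite size_mkseq => kw.
    rewrite nth_mkseq // nth_take // nth_drop /g add0r addrC.
    by rewrite -PoszD.
  move=> i n; rewrite lx.
  pose m := (`|i|%N + size p + size v)%N.
  pose us' := nseq m [:: 0%N] ++ us ++ nseq (m + n) [:: 0%N].
  exists us'; split.
    move=> u; rewrite !mem_cat !mem_nseq.
    by case/or3P => [/andP[_ /eqP->]| |/andP[_ /eqP->]];
      [exact: Ybeta0|exact: Yus|exact: Ybeta0].
  have fl0 k : flatten (nseq k [:: 0%N]) = nseq k 0%N by elim: k => //= k ->.
  have -> : flatten us' = nseq m 0%N ++ v ++ nseq (m + n) 0%N.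
    by rewrite !flatten_cat !fl0.
  set W := _ ++ _.
  have [j jE] : exists j : nat, j%:Z = i + (size p)%:Z + m%:Z.
    exists (absz (i + (size p)%:Z + m%:Z)%R); rewrite gez0_abs // /m; lia.
  have gE k : (k < n)%N -> g (i + k%:Z) = nth 0%N W (j + k).
    move=> kn; rewrite /g /W nth_cat size_nseq.
    have -> : i + k%:Z + (size p)%:Z = (j + k)%:Z - m%:Z by lia.
    have [jk|jk] := ltnP (j + k) m.
      rewrite nth_nseq jk.
      by have -> : (j + k)%:Z - m%:Z = Negz (m - (j + k)).-1 by lia.
    have -> : (j + k)%:Z - m%:Z = Posz (j + k - m) by lia.
    rewrite nth_cat.
    have [//|h] := ltnP.
    by rewrite [LHS]nth_default // nth_nseq; case: ifP.
  apply/infixP; exists (take j W), (drop (j + n) W).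
  have jn : (j + n <= size W)%N.
    rewrite /W !size_cat !size_nseq /m.
    rewrite /m in jE; lia.
  suff -> : mkseq (fun k => g (i + k%:Z)) n = take n (drop j W).
    by rewrite addnC -drop_drop cat_take_drop cat_take_drop.
  apply: (@eq_from_nth _ 0%N).
    by rewrite size_mkseq size_takel // size_drop leq_subRL //; lia.
  move=> k; rewrite size_mkseq => kn.
  by rewrite nth_mkseq // nth_take // nth_drop gE.
split; last first.
  move=> w; split; last by case/lang => x Sx xw; exists x, 0.
  by case=> x [i [Sx <-]]; exact: Sx.
have sigmaS p x : beta_shift beta x -> beta_shift beta (sigma p x).
  by move=> Sx i n; rewrite word_sigma.
split.
- have [|x Sx _] := lang [::]; last by exists x.
  by exists [::]; split.
- move=> x clx i n.
  have [y [Sy /= <-]] := clx _ (nbhs_word x i n).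
  exact: Sy.
- apply/seteqP; split=> [_ [x Sx <-]|x Sx]; first exact: sigmaS.
  by exists (sigma (- 1) x); [exact: sigmaS|exact: (@sigmaK _ (-1))].
Qed.

End BetaShiftIsSubshift.

(* Main.v *)
Require Import Defs.
From mathcomp Require Import all_boot all_order all_algebra.
From mathcomp Require Import all_classical all_reals all_analysis.
From mathcomp Require Import zify.
Set Implicit Arguments. Unset Strict Implicit. Unset Printing Implicit Defensive.
Import Order.TTheory GRing.Theory Num.Theory.
Local Open Scope classical_set_scope.
Local Open Scope ring_scope.

(** Write [d] for d(beta). If [d] were eventually periodic, a finite graph would
    present the beta-shift ([eventually_periodic_sofic]); so [d] is aperiodic,
    and then the beta-shift is the set of the sequences all of whose right tails
    are lexicographically at most [d] ([beta_shift_lexle]). The dynamical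
    arguments use only this description of the shift, the maximality of [d]
    among its own tails, and its aperiodicity. By compactness, an automorphism
    and its inverse are local with a common radius [R] ([Aut_half_inverse]).

    Existence of the intrinsic shift ([image_tail]). Let [x] be zero far to the
    left, with the right tail [d] at 0, and let [x'] be equal to [x] from 1 on and
    zero elsewhere. Then [x] and [x'] have the same right tail, but after [x'] up to
    [n] more continuations are possible than after [x]: some [y] agrees with [x']
    up to [n] and cannot be spliced onto [x] at [n] ([small_continuation]). As
    [F] is invertible and local, [F y] cannot be spliced onto [F x] at [n - R]
    either. Since [F x] and [F y] agree from [R + 1] up to [n - R], an occurrence
    of a prefix of [d] in [F x] starts at a position at most [R] and extends at
    least to [n - R]. The left tail of [F x] is constant, whereas [d] is not, so
    these starting positions are bounded below as well; one of them works for
    all [n], and there [F x] has the tail [d].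

    Blocking words ([trapped_stable]). Let [F] be shiftless; then [F] and its
    inverse [G] map long prefixes [d_0 ... d_(k-1)] at the origin to prefixes
    that are shorter by at most [R] ([preserves_prefix]). As [d] is aperiodic,
    there are large [n] and [m] for which [d] reads the same word of length
    [3R] before the positions [n] and [m], and [d_m < d_n]. Consider the
    points [x = ... d_0 ... d_(n-1) z] with the origin at [d_0], for which [z] may
    follow [d_0 ... d_(n-1)] but not [d_0 ... d_(m-1)]. Around the right end of
    the prefix, [F] and [G] cannot distinguish [n] from [m]; hence the part of
    [F x] from [n - R] on may not follow [d_0 ... d_(m-R-1)]. So it lies strictly
    above the tail of [d] at [m - R] and weakly below the one at [n - R]. These
    two tails share their first [R] letters, so [F x] starts with the whole word
    [d_0 ... d_(n-1)] again, and its remaining part still cannot follow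
    [d_0 ... d_(m-1)]. The set of these points is therefore mapped into itself,
    and it contains all points that start with [d_0 ... d_n], because [d_m < d_n].

    For a general automorphism, compose with the power of the shift that
    cancels the intrinsic shift. *)

(** * Cylinders and compactness *)
Section Topology.
Variable A : finType.
Implicit Types (x y : conf A) (X C : set (conf A)).

Definition cylinder N x := [set y : conf A | forall i : int, (`|i| <= N)%N -> y i = x i].

Lemma word_cylinder x y N :
  word y (- N%:Z) (N.*2).+1 = word x (- N%:Z) (N.*2).+1 -> cylinder N x y.
Proof.
move=> e i iN.
have := congr1 (fun s => nth (x 0) s `|(i + N%:Z)%R|%N) e.
rewrite !nth_mkseq; try lia.
by have -> : - N%:Z + `|(i + N%:Z)%R|%N%:Z = i by lia.
Qed.

Lemma cylinder_nbhs x N : nbhs x (cylinder N x).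
Proof.
by apply: filterS (nbhs_word x (- N%:Z) (N.*2).+1) => y; exact: word_cylinder.
Qed.

Lemma nbhs_cylinder x U : nbhs x U -> exists N, cylinder N x `<=` U.
Proof.
pose F : set_system (conf A) := filter_from [set: nat] (cylinder ^~ x).
have FF : Filter F.
  apply: filter_from_filter; first by exists 0%N.
  move=> i j _ _; exists (maxn i j) => // y h; split=> k hk; apply: h; lia.
suff : F --> x by move=> /[apply] -[N _ h]; exists N.
apply/cvg_sup => i U' [_ [[B Bop <-] Bx] BU].
by exists `|i|%N => // y yx; apply: BU; rewrite /= yx.
Qed.

(** Cylinders form a basis of neighbourhoods, so a set that contains every point
    approximated by its elements on all windows is closed. *)
Lemma closed_cylinder C :
  (forall x, (forall N, exists2 y, C y & cylinder N x y) -> C x) -> closed C.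
Proof.
move=> h x clx; apply: h => N.
by have [y [Cy yx]] := clx _ (cylinder_nbhs x N); exists y.
Qed.

Lemma conf_compact : compact [set: conf A].
Proof.
have fin (i : int) : compact [set: discrete_topology A].
  apply: finite_compact; exact: (@finite_finset A).
have := tychonoff fin.
by congr compact; apply/seteqP; split.
Qed.

Lemma bigcap_conf (C : nat -> set (conf A)) :
  (forall n, closed (C n)) -> (forall n, C n !=set0) ->
  (forall n, C n.+1 `<=` C n) -> exists x, forall n, C n x.
Proof.
move=> clC C0 mono.
pose F : set_system (conf A) := filter_from [set: nat] C.
have mon m n : (m <= n)%N -> C n `<=` C m.
  elim: n => [|n IH]; first by rewrite leqn0 => /eqP->.
  rewrite leq_eqVlt => /orP[/eqP->//|/IH]; exact: subset_trans (mono _).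
have FF : ProperFilter F.
  apply: filter_from_proper => //.
  apply: filter_from_filter; first by exists 0%N.
  move=> i j _ _; exists (maxn i j) => // y h; split; apply: mon h.
    exact: leq_maxl.
  exact: leq_maxr.
have [x [_ clx]] := conf_compact FF (filterT).
exists x => n; apply: clC => U Ux; apply: clx Ux; by exists n.
Qed.

End Topology.

(** * Cellular automata as local maps *)
Section LocalMaps.
Variable A : finType.
Implicit Types (x y : conf A) (X : set (conf A)) (F G : conf A -> conf A).

Definition is_local X R F := forall x y i, X x -> X y ->
  (forall j : int, (`|j - i| <= R)%N -> x j = y j) -> F x i = F y i.

Definition shift_equivariant X F :=
  forall p x, X x -> F (sigma p x) = sigma p (F x).

Lemma sigmaD p q x : sigma p (sigma q x) = sigma (p + q) x.
Proof. by apply/funext => i; rewrite /sigma addrA. Qed.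

Lemma sigma0 x : sigma 0 x = x.
Proof. by apply/funext => i; rewrite /sigma addr0. Qed.

Lemma subshift_sigma X : subshift X -> forall p x, X x -> X (sigma p x).
Proof.
case=> _ _ sX.
have pos (n : nat) x : X x -> X (sigma n x).
  elim: n => [|n IH] in x *; first by rewrite sigma0.
  by move=> Xx; rewrite intS -sigmaD -[X in X _]sX; exists (sigma n x) => //; exact: IH.
have neg (n : nat) x : X x -> X (sigma (- n%:Z) x).
  elim: n => [|n IH] in x *; first by rewrite oppr0 sigma0.
  move=> Xx; rewrite intS opprD addrC -sigmaD; apply: IH.
  by move: Xx; rewrite -{1}sX => -[y Xy <-]; rewrite sigmaK.
by case=> n x Xx; [exact: pos|rewrite NegzE; exact: neg].
Qed.

Lemma CA_sigma X F : subshift X -> CA X F -> shift_equivariant X F.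
Proof.
move=> sX [XF _ F1].
have pos (n : nat) x : X x -> F (sigma n x) = sigma n (F x).
  elim: n => [|n IH] in x *; first by rewrite !sigma0.
  move=> Xx; rewrite intS -sigmaD F1 ?IH ?sigmaD //.
  exact: (subshift_sigma sX).
case=> n x Xx; first exact: pos.
have Xn := subshift_sigma sX (Negz n) Xx.
have /(congr1 (sigma (Negz n))) := pos n.+1 _ Xn.
by rewrite !sigmaD NegzE subrr sigma0 addNr sigma0.
Qed.

Lemma CA_continuous X F x (i : int) : CA X F -> X x ->
  exists N, forall y, X y -> cylinder N x y -> F y i = F x i.
Proof.
case=> _ /subspace_continuousP cF _ Xx.
have [N NU] := nbhs_cylinder (cF x Xx _ (cylinder_nbhs (F x) `|i|%N)).
by exists N => y Xy /NU /(_ Xy); apply.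
Qed.

(** A compactness argument: otherwise, some pair of points with equal images by
    [P] would have distinct images by [Q]. *)
Lemma factor_local X (P Q : conf A -> conf A) : subshift X ->
  CA X P -> CA X Q -> (forall x y, X x -> X y -> P x = P y -> Q x = Q y) ->
  exists R, forall x y i, X x -> X y ->
    (forall j : int, (`|j - i| <= R)%N -> P x j = P y j) -> Q x i = Q y i.
Proof.
move=> sX cP cQ PQ; have [_ clX _] := sX.
pose fs (z : conf (A * A)%type) : conf A := fun i => (z i).1.
pose sn (z : conf (A * A)%type) : conf A := fun i => (z i).2.
pose C R : set (conf (A * A)%type) := [set z | [/\ X (fs z), X (sn z),
  (forall j : int, (`|j| <= R)%N -> P (fs z) j = P (sn z) j)
  & Q (fs z) 0 <> Q (sn z) 0]].
have mem z (pr : A * A -> A) : (forall N, exists2 y : conf A, X y &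
    forall i : int, (`|i| <= N)%N -> y i = pr (z i)) ->
    X (fun i => pr (z i)).
  move=> h; apply: clX => U /nbhs_cylinder[N NU].
  by have [y Xy yz] := h N; exists y; split=> //; apply: NU.
apply: contrapT => nR.
have [|||z Cz] := @bigcap_conf _ C.
- move=> R; apply: closed_cylinder => z zP.
  have Xf : X (fs z).
    apply: mem => N; have [y [Xy _ _ _] yz] := zP N.
    by exists (fs y) => // i iN; rewrite /fs yz.
  have Xs : X (sn z).
    apply: mem => N; have [y [_ Xy _ _] yz] := zP N.
    by exists (sn y) => // i iN; rewrite /sn yz.
  have ext (H : conf A -> conf A) (i : int) : CA X H ->
      exists N, forall (y : conf (A * A)%type), C R y ->
      cylinder N z y -> H (fs y) i = H (fs z) i /\ H (sn y) i = H (sn z) i.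
    move=> cH; have [N1 h1] := CA_continuous i cH Xf.
    have [N2 h2] := CA_continuous i cH Xs.
    exists (maxn N1 N2) => y [Xy1 Xy2 _ _] yz; split.
      by apply: h1 => // k kN; rewrite /fs yz //; lia.
    by apply: h2 => // k kN; rewrite /sn yz //; lia.
  split=> //.
    move=> j jR; have [N h] := ext P j cP; have [y Cy yz] := zP N.
    have [<- <-] := h y Cy yz; by case: Cy => _ _ ->.
  have [N h] := ext Q 0 cQ; have [y Cy yz] := zP N.
  have [<- <-] := h y Cy yz; by case: Cy.
- move=> R; apply: contrapT => C0; apply: nR; exists R => x y i Xx Xy Pxy.
  apply: contrapT => Qxy; apply: C0.
  exists (fun j => (x (j + i), y (j + i))); split.
  + exact: (subshift_sigma sX i Xx).
  + exact: (subshift_sigma sX i Xy).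
  + move=> j jR; rewrite -[fs _]/(sigma i x) -[sn _]/(sigma i y).
    rewrite !(CA_sigma sX cP) // /sigma; apply: Pxy.
    by rewrite addrK.
  + rewrite -[fs _]/(sigma i x) -[sn _]/(sigma i y).
    by rewrite !(CA_sigma sX cQ) // /sigma add0r.
- move=> R z [Xf Xs Pz Qz]; split=> // j jR; apply: Pz; lia.
have [Xf Xs _ Qz] := Cz 0%N; apply: Qz; rewrite (PQ (fs z) (sn z)) //.
by apply/funext => j; have [_ _ + _] := Cz `|j|%N; apply.
Qed.

Lemma CA_id X : CA X id.
Proof. by split=> //; apply: continuous_subspaceT => x; exact: cvg_id. Qed.

Lemma CA_local X F : subshift X -> CA X F -> exists R, is_local X R F.
Proof.
by move=> sX cF; apply: factor_local (CA_id X) cF _ => // x y _ _ ->.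
Qed.

(** Locality gives continuity; it is the way to see that [sigma p \o F] is again
    a cellular automaton. *)
Lemma local_CA X R F : set_fun X X F -> shift_equivariant X F ->
  is_local X R F -> CA X F.
Proof.
move=> XF sF lF; split=> //; last by move=> x; exact: sF.
apply/subspace_continuousP => x Xx U /nbhs_cylinder[N NU].
apply: filterS (cylinder_nbhs x (N + R)) => y yx Xy; apply: NU => i iN.
by apply: lF => // j ji; apply: yx; lia.
Qed.

Lemma local_radius X R F (a : A) : subshift X -> shift_equivariant X F ->
  is_local X R F -> has_radius X R F.
Proof.
move=> sX sF lF.
pose D w := [set x | X x /\ word x (- R%:Z) (R.*2).+1 = w].
exists (fun w => F (xget (fun=> a) (D w)) 0) => x Xx i.
have Dx : D (word x (i - R%:Z) (R.*2).+1) (sigma i x).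
  split; first exact: (subshift_sigma sX).
  by rewrite word_sigma addrC.
have [Xy yw] := xgetI (fun=> a) Dx.
set y := xget _ _ in Xy yw *.
have -> : F x i = F (sigma i x) 0 by rewrite sF // /sigma add0r.
apply: lF => //; first exact: (subshift_sigma sX).
by move=> j; rewrite subr0; apply: word_cylinder; case: Dx => _ ->.
Qed.

(** One direction of a reversible cellular automaton, kept separate so that
    [half_inverse X R F G] and [half_inverse X R G F] make [F] and [G]
    interchangeable. *)
Definition half_inverse X R F G :=
  [/\ set_fun X X F, shift_equivariant X F, is_local X R F &
      forall x, X x -> G (F x) = x].

(** Injectivity says that [F x] determines [x], hence locally so by
    [factor_local]; this is the locality of the inverse. *)
Lemma Aut_half_inverse X F : subshift X -> Aut X F ->
  exists R G, half_inverse X R F G /\ half_inverse X R G F.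
Proof.
move=> sX [cF [XF injF surjF]].
have sF := CA_sigma sX cF.
have /choice[G GP] y : exists x, X y -> X x /\ F x = y.
  have [Xy|nXy] := pselect (X y); last by exists y.
  by have [x Xx <-] := surjF y Xy; exists x.
have inj x y : X x -> X y -> F x = F y -> x = y.
  by move=> Xx Xy; apply: injF; rewrite inE.
have XG y : X y -> X (G y) by move=> /GP[].
have FG y : X y -> F (G y) = y by move=> /GP[].
have [R1 l1] := CA_local sX cF.
have [R2 l2] := factor_local sX cF (CA_id X) inj.
exists (maxn R1 R2), G; split; split=> //.
- by move=> x y i Xx Xy xy; apply: l1 => // j ji; apply: xy; lia.
- by move=> x Xx; apply: inj; rewrite ?FG //; [apply: XG|]; exact: XF.
- move=> p y Xy; have Xpy := subshift_sigma sX p Xy.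
  apply: inj; [exact: XG|apply: (subshift_sigma sX); exact: XG|].
  by rewrite FG // sF ?FG //; exact: XG.
- move=> x y i Xx Xy xy; apply: (l2 (G x) (G y)); [exact: XG..|].
  by move=> j ji; rewrite !FG //; apply: xy; lia.
Qed.

Lemma half_inverse_sigma X R F G p : subshift X ->
  half_inverse X R F G -> half_inverse X R G F ->
  half_inverse X (R + `|p|) (sigma p \o F) (G \o sigma (- p)) /\
  half_inverse X (R + `|p|) (G \o sigma (- p)) (sigma p \o F).
Proof.
move=> sX [XF sF lF GF] [XG sG lG FG].
have sigX q x := @subshift_sigma X sX q x.
split; split.
- by move=> x Xx; apply: sigX; exact: XF.
- by move=> q x Xx /=; rewrite sF // !sigmaD addrC.
- move=> x y i Xx Xy xy; apply: lF => // j ji; apply: xy; lia.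
- by move=> x Xx /=; rewrite sigmaD addNr sigma0 GF.
- by move=> x Xx; apply: XG; exact: sigX.
- by move=> q x Xx /=; rewrite -sG ?sigmaD 1?addrC //; exact: sigX.
- move=> x y i Xx Xy xy; apply: lG; [exact: sigX..|] => j ji.
  apply: xy; lia.
- by move=> x Xx /=; rewrite FG ?sigmaD ?subrr ?sigma0 //; exact: sigX.
Qed.

End LocalMaps.

(** * Lexicographic order *)
Section Lex.
Implicit Types a b c : nat -> nat.

(** Quantifying over the common prefixes, rather than over a first difference,
    makes the order directly usable in inductions and covers equality. *)
Definition lexle a b := forall n, (forall i, (i < n)%N -> a i = b i) -> (a n <= b n)%N.

Definition suffix_at k a : nat -> nat := fun i => a (k + i)%N.

Lemma lexle_trans b a c : lexle a b -> lexle b c -> lexle a c.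
Proof.
move=> ab bc n ac.
have eb i : (i <= n)%N -> (forall j, (j < i)%N -> a j = b j /\ b j = c j).
  elim: i => // i IH le j; rewrite ltnS leq_eqVlt => /orP[/eqP->|]; last by apply: IH; lia.
  have h := IH (ltnW le).
  have h1 : (a i <= b i)%N by apply: ab => k /h[].
  have h2 : (b i <= c i)%N by apply: bc => k /h[].
  have := ac i le; lia.
have h := eb n (leqnn n).
apply: (@leq_trans (b n)); first by apply: ab => k /h[].
by apply: bc => k /h[].
Qed.

Lemma not_lexle a b : ~ lexle a b ->
  exists2 n, (forall i, (i < n)%N -> a i = b i) & (b n < a n)%N.
Proof.
move=> /existsNP[n /not_implyP[e /negP]]; rewrite -ltnNge => h; by exists n.
Qed.

Lemma lexle_anti a b : lexle a b -> lexle b a -> a =1 b.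
Proof.
move=> ab ba n; have [m] := ubnP n; elim: m n => // m IH n nm.
have e i : (i < n)%N -> a i = b i by move=> h; apply: IH; lia.
apply/eqP; rewrite eqn_leq ab // ba // => i /e //.
Qed.

Lemma lexle_suffix k a b : (forall i, (i < k)%N -> a i = b i) ->
  lexle a b -> lexle (suffix_at k a) (suffix_at k b).
Proof.
move=> e ab n en; apply: ab => i ik.
have [/e//|ki] := ltnP i k.
have := en (i - k)%N; rewrite /suffix_at subnKC //; apply; lia.
Qed.

Lemma lexle_eq a a' b b' : a =1 a' -> b =1 b' -> lexle a b -> lexle a' b'.
Proof. by move=> /funext-> /funext->. Qed.

End Lex.

(** If every index failed at some stage, all of them would fail at the largest
    of these stages. *)
Lemma antitone_pigeonhole n (P : 'I_n -> nat -> Prop) :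
  (forall i k l, (k <= l)%N -> P i l -> P i k) ->
  (forall k, exists i, P i k) -> exists i, forall k, P i k.
Proof.
move=> mono ex; apply: contrapT => none.
have {none} /choice[f fP] i : exists k, ~ P i k.
  by apply/existsNP => h; apply: none; exists i.
have [i Pi] := ex (\max_i f i).
by apply: (fP i); apply: mono Pi; exact: leq_bigmax.
Qed.

(** * Points bounded by a shift-maximal aperiodic sequence *)
Section LexShift.
Variables (B : nat) (d : nat -> nat).
Local Notation A := ('I_B.+1).
Implicit Types (x y u v : conf A) (c : int) (k n m : nat).

Definition digit x i : nat := val (x i : A).

Definition tail x i : nat -> nat := fun k => digit x (i + k%:Z).

Definition lexshift : set (conf A) := [set x | forall i, lexle (tail x i) d].
Local Notation X := lexshift.

Hypothesis d_le : forall k, (d k <= B)%N.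
Hypothesis d_max : forall k, lexle (suffix_at k d) d.
Hypothesis d_aper : forall n p, (0 < p)%N -> exists k, d (n + k)%N <> d (n + p + k)%N.

Lemma digit_inj x y i : digit x i = digit y i -> x i = y i.
Proof. by move/val_inj. Qed.

Lemma d0_gt0 : (0 < d 0)%N.
Proof.
rewrite lt0n; apply/eqP => d0.
have dk k : d k = 0%N.
  have := @d_max k 0%N; rewrite /suffix_at addn0 d0 leqn0 => h.
  by apply/eqP; apply: h.
by have [k] := @d_aper 0%N 1%N isT; rewrite !dk.
Qed.

Lemma lexshift_sigma p x : X x -> X (sigma p x).
Proof.
move=> Xx i; apply: lexle_eq (Xx (i + p)) => // k.
by rewrite /tail /digit /sigma addrAC.
Qed.

Definition dpoint c : conf A :=
  fun i => if i < c then ord0 else inord (d `|i - c|%N).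

Lemma digit_dpoint c i : digit (dpoint c) i = if i < c then 0%N else d `|i - c|%N.
Proof. by rewrite /digit /dpoint; case: ifP => //= _; rewrite inordK // ltnS. Qed.

Lemma digit_dpoint_ge c i n : i = c + n%:Z -> digit (dpoint c) i = d n.
Proof.
move=> ->; rewrite digit_dpoint; case: ifP; first lia.
by move=> _; congr d; lia.
Qed.

Lemma tail_dpoint c : tail (dpoint c) c =1 d.
Proof. by move=> k; exact: digit_dpoint_ge. Qed.

Lemma lexshift_dpoint c : X (dpoint c).
Proof.
move=> i; have [ic|ci] := ltP i c.
  move=> [|n] e; first by rewrite /tail addr0 digit_dpoint ic.
  have := e 0%N isT; rewrite /tail addr0 digit_dpoint ic => d0.
  by have := d0_gt0; rewrite -d0.
have -> // : tail (dpoint c) i = suffix_at `|i - c|%N d.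
by apply/funext => k; apply: digit_dpoint_ge; lia.
Qed.

Definition glue c u v : conf A := fun i => if i < c then u i else v i.

Lemma glue_lt c u v i : i < c -> glue c u v i = u i.
Proof. by rewrite /glue => ->. Qed.

Lemma glue_ge c u v i : c <= i -> glue c u v i = v i.
Proof. by rewrite /glue leNgt => /negbTE->. Qed.

(** A tail of the glued point that starts before [c] is compared with [d] by the
    letters of [u] unless these form a prefix of [d]; only then does [v]
    matter. *)
Lemma lexshift_glue c u v : X u -> X v ->
  (forall k, (forall i : nat, (i < k)%N -> digit u (c - k%:Z + i%:Z) = d i) ->
     lexle (tail v c) (suffix_at k d)) -> X (glue c u v).
Proof.
move=> Xu Xv h j; have [jc|cj] := ltP j c; last first.
  apply: lexle_eq (Xv j) => // k.
  by rewrite /tail /digit glue_ge //; lia.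
move=> n e; have [k jk] : exists k : nat, j = c - k%:Z.
  by exists `|c - j|%N; lia.
subst j; have [nk|kn] := ltnP n k.
  have E (i : nat) : (i <= n)%N -> tail (glue c u v) (c - k%:Z) i = tail u (c - k%:Z) i.
    by move=> ni; rewrite /tail /digit glue_lt //; lia.
  by rewrite E //; apply: Xu => i lin; rewrite -E ?e //; exact: ltnW.
have E (i : nat) : tail (glue c u v) (c - k%:Z) (k + i) = tail v c i.
  rewrite /tail /digit.
  have -> : c - k%:Z + (k + i)%:Z = c + i%:Z by lia.
  by rewrite glue_ge //; lia.
have H : lexle (tail v c) (suffix_at k d).
  apply: h => i ik; rewrite -e; last lia.
  by rewrite /tail /digit glue_lt //; lia.
have nE : n = (k + (n - k))%N by lia.
rewrite nE E; apply: H => i ink; rewrite -E e /suffix_at //; lia.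
Qed.

Lemma lexshift_zero_left c v : X v -> X (glue c (fun=> ord0) v).
Proof.
move=> Xv; apply: lexshift_glue => //.
move=> [|k] h; first exact: Xv.
by have := h 0%N isT; have := d0_gt0; rewrite /digit /= => + d0; rewrite -d0.
Qed.

(** Both occurrences of [d] are seen on the common right tail, so two distinct
    positions would make [d] eventually periodic. *)
Lemma tail_unique c x y i j : (forall l, c <= l -> x l = y l) ->
  tail x i =1 d -> tail y j =1 d -> i = j.
Proof.
wlog ij : x y i j / i <= j.
  move=> W e xd yd; have [ij|/ltW ji] := leP i j; first exact: (W x y).
  by apply/esym; apply: (W y x) => // l /e.
move=> e xd yd; apply: contrapT => nij.
have ji0 : (0 < `|(j - i)%R|)%N by lia.
have [k] := @d_aper `|(Num.max c j - j)%R|%N _ ji0.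
apply; rewrite -[LHS]yd -[RHS]xd /tail /digit; congr (val _).
have -> : i + (`|(Num.max c j - j)%R| + `|(j - i)%R| + k)%N%:Z =
          j + (`|(Num.max c j - j)%R| + k)%N%:Z by lia.
by rewrite e //; lia.
Qed.


Lemma aperiodic_step : exists k, d k <> d k.+1.
Proof. by have [k] := @d_aper 0%N 1%N isT; exists k. Qed.

(** * Images of points with the tail d *)
Section TransportTail.
Variables (R : nat) (F G : conf A -> conf A).
Hypotheses (hF : half_inverse X R F G) (hG : half_inverse X R G F).

(** [p] is the starting position of the longest proper border of [d_0 ... d_n];
    [p = n.+1] stands for the empty border. *)
Lemma least_border n : exists p, [/\ (0 < p)%N, (p <= n.+1)%N,
  (forall i : nat, (p + i <= n)%N -> d (p + i)%N = d i) &
  forall s, (0 < s)%N -> (s < p)%N ->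
    exists2 i, (s + i <= n)%N & d (s + i)%N <> d i].
Proof.
pose P p := (0 < p)%N && [forall i : 'I_n.+1, (p + i <= n)%N ==> (d (p + i)%N == d i)].
have exP : exists p, P p.
  by exists n.+1; apply/andP; split=> //; apply/forallP => i; apply/implyP; lia.
case: (ex_minnP exP) => p /andP[p0 /forallP h] pmin; exists p; split=> //.
- by apply: pmin; apply/andP; split=> //; apply/forallP => i; apply/implyP; lia.
- move=> i pin; have hi : (i < n.+1)%N by lia.
  by have /implyP/(_ pin)/eqP := h (Ordinal hi).
- move=> s s0 sp; apply: contrapT => no.
  suff /pmin : P s by lia.
  apply/andP; split=> //; apply/forallP => i; apply/implyP => sin.
  by apply/eqP; apply: contrapT => ne; apply: no; exists i.
Qed.

(** Let [p] be given by [least_border]. The point [y] is [0 0 0 d_1 ... d_(p-1)]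
    followed by [d]: it reads [d_1 ... d_n] and then goes on as [d] does at
    [n + 1 - p]. After [d_0 ... d_n] that continuation is too large, since the tail
    of [d] at [n + 1] is smaller by maximality of [d], and strictly so by
    aperiodicity. The choice of the longest border makes [y] admissible. *)
Lemma small_continuation x n : X x -> tail x 0 =1 d ->
  exists y, [/\ X y,
    forall i : int, i <= n%:Z -> y i = glue 1 (fun=> ord0) x i &
    forall g, X g -> (forall i : int, 0 <= i <= n%:Z -> g i = x i) ->
      (forall i : int, n%:Z < i -> g i = y i) -> False].
Proof.
move=> Xx xd; have [p [p0 pn hp pmin]] := least_border n.
pose x' := glue 1 (fun=> ord0) x.
have xE (k : nat) (i : int) : i = k%:Z -> digit x i = d k.
  by move=> ->; rewrite -xd /tail add0r.
have x'E (k : nat) (i : int) : i = k.+1%:Z -> digit x' i = d k.+1.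
  by move=> iE; rewrite /digit /x' glue_ge -?/(digit x _) ?(xE k.+1) //; lia.
have x'0 (i : int) : i <= 0 -> digit x' i = 0%N.
  by move=> iE; rewrite /digit /x' glue_lt //; lia.
have Xx' : X x' by exact: lexshift_zero_left.
exists (glue p%:Z x' (dpoint p%:Z)); split.
- apply: lexshift_glue => //; first exact: lexshift_dpoint.
  have -> : tail (dpoint p%:Z) p%:Z = d by apply/funext => i; rewrite tail_dpoint.
  case=> [_ //|k] hk; have [pk|kp] := leqP p k.+1.
    have := hk 0%N isT; rewrite x'0; last lia.
    by move=> d0; have := d0_gt0; rewrite -d0.
  have ex_i : exists i, (p - k.+1 + i <= n)%N && (d (p - k.+1 + i)%N != d i).
    have [||i ? /eqP ?] := pmin (p - k.+1)%N; [lia|lia|].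
    by exists i; apply/andP.
  case: (ex_minnP ex_i) => i /andP[sin /eqP ne] imin.
  have eq_i l : (l < i)%N -> d (p - k.+1 + l)%N = d l.
    move=> li; apply/eqP; apply/negPn/negP => nel.
    have : (i <= l)%N by apply: imin; rewrite nel andbT; lia.
    by rewrite leqNgt li.
  have ki : (k < i)%N.
    rewrite ltnNge; apply/negP => ik; apply: ne; rewrite -(hk _ ik).
    by rewrite (x'E (p - k.+1 + i).-1); [congr d; lia|lia].
  have lti : (d (i - k.+1)%N < d i)%N.
    rewrite -(hp (i - k.+1)%N); last lia.
    rewrite (_ : (p + (i - k.+1))%N = (p - k.+1 + i)%N); last lia.
    by rewrite ltn_neqAle; apply/andP; split; [exact/eqP|exact: d_max].
  move=> m e; rewrite /suffix_at.
  have [mi|im] := ltnP m (i - k.+1)%N.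
    rewrite -(hp m); last lia.
    rewrite -(eq_i (k.+1 + m)%N); last lia.
    by rewrite (_ : (p - k.+1 + (k.+1 + m))%N = (p + m)%N) //; lia.
  move: im; rewrite leq_eqVlt => /orP[/eqP<-|im].
    by rewrite subnKC //; exact: ltnW.
  have := e _ im; rewrite /suffix_at subnKC // => h; lia.
- move=> i iN; have [ip|pi] := ltP i p%:Z; first by rewrite glue_lt.
  rewrite glue_ge //; apply: digit_inj.
  rewrite (@digit_dpoint_ge _ _ `|i - p%:Z|%N); last lia.
  rewrite (x'E `|i|.-1); last lia.
  have := hp `|i - p%:Z|%N; rewrite (_ : (p + _)%N = `|i|.-1.+1); last lia.
  by move=> <- //; lia.
- move=> g Xg gx gy.
  have g1 (k : nat) : (k <= n)%N -> tail g 0 k = d k.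
    by move=> kn; rewrite /tail add0r /digit gx -?/(digit _ _) ?(xE k) //; lia.
  have g2 (k : nat) : (n < k)%N -> tail g 0 k = d (k - p)%N.
    move=> kn; rewrite /tail add0r /digit gy ?glue_ge -?/(digit _ _); [|lia..].
    by rewrite (@digit_dpoint_ge _ _ (k - p)%N) //; lia.
  have le1 : lexle (suffix_at (n.+1 - p) d) (suffix_at n.+1 d).
    apply: lexle_eq (lexle_suffix (k := n.+1) _ (Xg 0)) => // k.
      by rewrite /suffix_at g2; [congr d; lia|lia].
  have le2 : lexle (suffix_at n.+1 d) (suffix_at (n.+1 - p) d).
    apply: lexle_eq (lexle_suffix (k := (n.+1 - p)%N) _ (@d_max p)) => // k.
      by rewrite /suffix_at; congr d; lia.
    by move=> kn; rewrite /suffix_at hp //; lia.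
  have [k] := @d_aper (n.+1 - p)%N p p0; apply.
  by have := lexle_anti le1 le2 k; rewrite /suffix_at subnK.
Qed.


(** Suppose that [q], made of [F x] up to [n - R] and of [F y] afterwards for [y]
    as in [small_continuation], were in the shift: then [G q] would be [x] up to
    [n] followed by [y]. So some tail of [q] exceeds [d]. It starts at [R] or
    before, as [q] is [F y] from [R + 1] on, and it is equal to [d] at least up to
    [n - R], as [q] is [F x] there. *)
Lemma image_prefix x n : X x -> tail x 0 =1 d -> (4 * R < n)%N ->
  exists2 j : int, j <= R%:Z &
    forall k, j + k%:Z <= n%:Z - R%:Z -> tail (F x) j k = d k.
Proof.
move=> Xx xd Rn; have [XF _ lF GF] := hF; have [XG _ lG FG] := hG.
have [y [Xy yx' forb]] := small_continuation n Xx xd.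
have yx (i : int) : 1 <= i <= n%:Z -> y i = x i.
  by case/andP=> i1 iN; rewrite yx' // glue_ge.
pose q := glue (n%:Z - R%:Z + 1) (F x) (F y).
have qx (i : int) : i <= n%:Z - R%:Z -> q i = F x i.
  by move=> iN; rewrite /q glue_lt //; lia.
have qy (i : int) : R%:Z < i -> q i = F y i.
  move=> iR; have [iN|Ni] := leP i (n%:Z - R%:Z); last by rewrite /q glue_ge //; lia.
  by rewrite qx //; apply: lF => // j ji; apply/esym; apply: yx; lia.
have nXq : ~ X q.
  move=> Xq; (* The ranges of [gx] and [gy] overlap because [4 * R < n]. *)
  have gx (i : int) : i <= n%:Z - R%:Z - R%:Z -> G q i = x i.
    move=> iN; rewrite -[in RHS](GF x Xx); apply: lG => //; first exact: XF.
    by move=> j ji; apply: qx; lia.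
  have gy (i : int) : R%:Z + R%:Z < i -> G q i = y i.
    move=> iN; rewrite -[in RHS](GF y Xy); apply: lG => //; first exact: XF.
    by move=> j ji; apply: qy; lia.
  apply: (forb (G q)) => [|i iN|i iN]; first exact: XG.
    have [h|h] := leP i (n%:Z - R%:Z - R%:Z); first exact: gx.
    by rewrite gy ?yx //; lia.
  by apply: gy; lia.
have [j /not_lexle[m e lt]] : exists j, ~ lexle (tail q j) d by apply/existsNP.
have jR : j <= R%:Z.
  rewrite leNgt; apply/negP => Rj; have := XF _ Xy j m.
  have E k : tail (F y) j k = tail q j k by rewrite /tail /digit qy //; lia.
  by rewrite E leqNgt lt => h; have : false by apply: h => k /e; rewrite E.
have jm : n%:Z - R%:Z < j + m%:Z.
  rewrite ltNge; apply/negP => h; have := XF _ Xx j m.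
  have E k : (k <= m)%N -> tail (F x) j k = tail q j k.
    by move=> km; rewrite /tail /digit qx //; lia.
  rewrite E // leqNgt lt => h'; have : false by apply: h' => k km; rewrite E ?e // ltnW.
  by [].
exists j => // k jk; rewrite -e; last lia.
by rewrite /tail /digit qx.
Qed.

(** The candidates for the position of the tail are bounded above by
    [image_prefix]. They are bounded below because the left tail of [F x] is
    constant, while [d_l <> d_(l+1)] for some [l]. *)
Lemma image_tail_zero_left x c : X x -> tail x 0 =1 d ->
  (forall i : int, i < c -> x i = ord0) -> exists i, tail (F x) i =1 d.
Proof.
move=> Xx xd x0; have [XF sF lF _] := hF.
have [l dl] := aperiodic_step.
have const (i : int) : i + R%:Z + 1 < c -> F x (i + 1) = F x i.
  move=> ic; rewrite -[LHS]/(sigma 1 (F x) i) -sF //; apply: lF => //.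
    exact: lexshift_sigma.
  by move=> j ji; rewrite /sigma !x0 //; lia.
(* A prefix of [d] of length [l + 2] starting left of [b] would lie in the
   constant left tail of [F x]. *)
pose b := Num.min (c - R%:Z - l%:Z - 2%:Z) R%:Z.
pose N := (4 * R + l + 2)%N.
pose at_ i (k : nat) := tail (F x) (b + i%:Z) k = d k.
have [||i iP] := @antitone_pigeonhole `|R%:Z - b|.+1
    (fun i k => forall m, (m <= k)%N -> b + (nat_of_ord i)%:Z + m%:Z <= k%:Z ->
       at_ (nat_of_ord i) m).
- move=> i k m km h l' l'k h'; apply: h; lia.
- move=> k; have [|j jR jk] := @image_prefix x (N + R + k)%N Xx xd; first lia.
  have jb : b <= j.
    rewrite leNgt; apply/negP => jb; apply: dl.
    rewrite -!jk; [|lia..].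
    rewrite /tail /digit -(const (j + l%:Z)); last lia.
    by congr (val (F x _)); lia.
  have ji : (`|(j - b)%R| < `|(R%:Z - b)%R|.+1)%N by lia.
  exists (Ordinal ji) => m mk /= h.
  rewrite /at_ (_ : b + _ = j); last lia.
  by apply: jk; lia.
exists (b + (nat_of_ord i)%:Z) => m.
by apply: (iP (m + `|(b + (nat_of_ord i)%:Z + m%:Z)%R|)%N); lia.
Qed.

(** Replacing the far left of [x] by zeros does not change [F x] near the
    position [i]. All points obtained so have images with a common right tail,
    and this determines [i]. *)
Lemma image_tail : exists i, forall x, X x -> tail x 0 =1 d -> tail (F x) i =1 d.
Proof.
have [XF _ lF _] := hF.
have [|i iP] := @image_tail_zero_left (dpoint 0) 0 (@lexshift_dpoint 0) (@tail_dpoint 0).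
  by move=> i i0; apply: digit_inj; rewrite digit_dpoint i0.
exists i => x Xx xd.
pose c := Num.min 0 (i - R%:Z); pose z := glue c (fun=> ord0) x.
have Xz : X z by exact: lexshift_zero_left.
have zx (j : int) : c <= j -> z j = x j by move=> cj; rewrite /z glue_ge.
have zd : tail z 0 =1 d by move=> k; rewrite -xd /tail /digit zx //; lia.
have [j' zP] : exists j, tail (F z) j =1 d.
  by apply: (@image_tail_zero_left z c) => // j jc; rewrite /z glue_lt.
have ij : i = j'.
  apply: (tail_unique (c := R%:Z) _ iP zP) => l Rl.
  apply: lF => //; first exact: lexshift_dpoint.
  move=> j jl; have [k jE] : exists k : nat, j = k%:Z by exists `|j|%N; lia.
  by apply: digit_inj; rewrite (digit_dpoint_ge (n := k)) -?zd /tail ?add0r // jE.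
move=> k; rewrite -zP -ij /tail /digit; congr (val _).
by apply: lF => // j ji; apply/esym; apply: zx; lia.
Qed.


End TransportTail.

(** * Trapped points and blocking words *)

Definition preserves_tail (F : conf A -> conf A) :=
  forall x, X x -> tail x 0 =1 d -> tail (F x) 0 =1 d.

(** Before the position [R], [F x] also depends on letters of [x] left of the
    origin. But [n] may be taken beyond all the first differences between [d] and
    its tails at [1, ..., R]; then the [R] letters of [x] before a prefix of [d] of
    length [n] may be followed by [d] itself, and [F] preserves that tail. *)
Lemma preserves_prefix R (F : conf A -> conf A) : set_fun X X F -> is_local X R F ->
  preserves_tail F ->
  exists N, forall n x, (N <= n)%N -> X x ->
    (forall k, (k < n)%N -> tail x 0 k = d k) ->
    forall k, (k + R < n)%N -> tail (F x) 0 k = d k.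
Proof.
move=> XF lF Fd.
(* [q k] is the first difference between [d] and its tail at [k]. *)
have /choice[q qP] (k : nat) : exists q, (0 < k)%N ->
    (forall i : nat, (i < q)%N -> d (k + i)%N = d i) /\ (d (k + q)%N < d q)%N.
  case: k => [|k]; first by exists 0%N.
  have [l dl] := @d_aper 0%N k.+1 isT.
  have /not_lexle[q e lt] : ~ lexle d (suffix_at k.+1 d).
    by move=> /(lexle_anti (@d_max k.+1))/(_ l); exact/nesym.
  by exists q => _; split=> // i /e.
pose N := (R + R + \max_(k < R.+1) (q k).+1)%N.
exists N => n x Nn Xx xd k kn.
pose z := glue (- R%:Z) (fun=> ord0) x.
have Xz : X z by exact: lexshift_zero_left.
pose y := glue 0 z (dpoint 0).
have Xy : X y.
  apply: lexshift_glue => //; first exact: lexshift_dpoint.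
  have -> : tail (dpoint 0) 0 = d by apply/funext => i; rewrite tail_dpoint.
  case=> [_ //|l] zl; have [lR|Rl] := leqP l.+1 R; last first.
    have := zl 0%N isT; rewrite /z /digit glue_lt /=; last lia.
    by move=> d0; have := d0_gt0; rewrite -d0.
  have [e lt] := qP l.+1 isT; exfalso.
  have ql : (q l.+1 < n)%N.
    have := leq_bigmax (F := fun k : 'I_R.+1 => (q k).+1) (Ordinal (lR : (l.+1 < R.+1)%N)).
    by move=> /leq_trans; apply; apply: leq_trans Nn; exact: leq_addl.
  have xl (i : nat) : (i < n)%N -> tail x (- l.+1%:Z) (l.+1 + i) = d i.
    by move=> iN; rewrite -xd // /tail; congr digit; lia.
  have := Xx (- l.+1%:Z) (l.+1 + q l.+1)%N; rewrite xl // leqNgt lt => h.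
  have : false; last by [].
  apply: h => i iq; have [il|li] := ltnP i l.+1.
    rewrite -zl // /tail /digit /z glue_ge; last lia.
    by congr (val (x _)); lia.
  have -> : i = (l.+1 + (i - l.+1))%N by lia.
  by rewrite xl; [rewrite e //; lia|lia].
have yd : tail y 0 =1 d.
  by move=> i; rewrite -[RHS](@tail_dpoint 0) /tail /digit /y glue_ge //; lia.
rewrite -(Fd y Xy yd) /tail /digit; congr (val _).
apply: lF => // j jk; have [j0|j0] := ltP j 0.
  by rewrite /y glue_lt // /z glue_ge //; lia.
apply: digit_inj; have [m jE] : exists m : nat, j = 0 + m%:Z by exists `|j|%N; lia.
rewrite jE -/(tail x 0 m) -/(tail y 0 m) yd xd //; lia.
Qed.

(** Otherwise each letter would be determined by the [K] letters before it; two
    occurrences of a word of length [K] would then make [d] eventually periodic. *)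
Lemma right_special_factor K N : exists n m, [/\ (N <= n)%N, (N <= m)%N,
  forall i : nat, (i < K)%N -> d (n + i)%N = d (m + i)%N &
  (d (m + K)%N < d (n + K)%N)%N].
Proof.
apply: contrapT => no.
have det n m : (N <= n)%N -> (N <= m)%N ->
    (forall i : nat, (i < K)%N -> d (n + i)%N = d (m + i)%N) ->
    d (n + K)%N = d (m + K)%N.
  move=> Nn Nm e; case: (ltngtP (d (n + K)%N) (d (m + K)%N)) => // lt.
    by exfalso; apply: no; exists m, n; split=> // i /e.
  by exfalso; apply: no; exists n, m.
pose f (a : 'I_#|{ffun 'I_K -> A}|.+1) : {ffun 'I_K -> A} :=
  [ffun i : 'I_K => inord (d (N + a + i)%N)].
have /injectivePn[a [b ab fab]] : ~~ injectiveb f.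
  by apply/negP => /injectiveP/leq_card; rewrite card_ord ltnn.
wlog lt_ab : a b ab fab / (a < b)%N.
  move=> W; case: (ltngtP a b) => h.
  - exact: (W a b).
  - by apply: (W b a) => //; rewrite eq_sym.
  - by move/val_inj: h ab => ->; rewrite eqxx.
have e k : d (N + a + k)%N = d (N + b + k)%N.
  have [l] := ubnP k; elim: l k => // l IH k kl.
  have [kK|Kk] := ltnP k K.
    have /(congr1 (fun g : {ffun 'I_K -> A} => val (g (Ordinal kK)))) := fab.
    by rewrite /= !ffunE /= !inordK // ltnS.
  have E (s : nat) : (N + s + k = N + s + (k - K) + K)%N by lia.
  rewrite !E; apply: det; [lia|lia|] => i iK.
  by have := IH (k - K + i)%N; rewrite !addnA; apply; lia.
have ab0 : (0 < b - a)%N by lia.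
have [k] := @d_aper (N + a)%N _ ab0; apply; rewrite e; congr d; lia.
Qed.

(** The image of 000...d has the tail [d] at some [i], and [G] brings this tail
    back to [0] after a shift by [i]; as [d] occurs only once, [i = 0]. *)
Lemma preserves_tail_inverse R (F G : conf A -> conf A) :
  half_inverse X R F G -> half_inverse X R G F ->
  preserves_tail G -> preserves_tail F.
Proof.
move=> hF hG Gd; have [i iP] := image_tail hF hG.
have [XF _ _ GF] := hF; have [_ sG _ _] := hG.
have Xd := @lexshift_dpoint 0; have XFd := XF _ Xd.
suff i0 : i = 0 by move=> x Xx xd; rewrite -i0; exact: iP.
apply: (@tail_unique 0 (dpoint 0) (dpoint 0)) => //; last exact: tail_dpoint.
have sd : tail (sigma i (F (dpoint 0))) 0 =1 d.
  by move=> k; rewrite -(iP _ Xd (@tail_dpoint 0)) /tail /digit /sigma; congr (val (F _ _)); lia.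
move=> k; rewrite -(Gd _ (lexshift_sigma XFd) sd) sG // GF //.
by rewrite /tail /digit /sigma; congr (val (dpoint _ _)); lia.
Qed.

Section MainArgument.
Variables (R : nat) (F G : conf A -> conf A).
Hypotheses (hF : half_inverse X R F G) (hG : half_inverse X R G F).
Hypotheses (Fd : preserves_tail F) (Gd : preserves_tail G).

(** By the last condition, what follows [d_0 ... d_(n-1)] in [x] could not follow
    [d_0 ... d_(m-1)] in any point of the shift. *)
Definition trapped n m x := [/\ X x, forall k, (k < n)%N -> tail x 0 k = d k &
  ~ lexle (tail x n%:Z) (suffix_at m d)].

(** If the part of [F x] from [n - R] on could follow [d_0 ... d_(m-R-1)], then the
    image by [G] of the resulting point would be [d_0 ... d_(m-1)] followed by the
    part of [x] from [n] on, which is excluded. *)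
Lemma trapped_stable : exists N, forall n m,
  (N <= n)%N -> (N <= m)%N ->
  (forall i, (i < 3 * R)%N -> d (n - 3 * R + i)%N = d (m - 3 * R + i)%N) ->
  forall x, trapped n m x -> trapped n m (F x).
Proof.
have [XF sF lF GF] := hF; have [XG sG lG FG] := hG.
have [N1 h1] := preserves_prefix XF lF Fd.
have [N2 h2] := preserves_prefix XG lG Gd.
exists (N1 + N2 + 4 * R)%N => n m Nn Nm past x [Xx xn xm].
have past' k : (0 < k)%N -> (k <= 3 * R)%N -> d (n - k)%N = d (m - k)%N.
  move=> k0 kR; have := past (3 * R - k)%N.
  rewrite (_ : (n - 3 * R + _ = n - k)%N); last lia.
  by rewrite (_ : (m - 3 * R + _ = m - k)%N); [apply; lia|lia].
have wn k : (k + R < n)%N -> tail (F x) 0 k = d k.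
  by apply: h1 => //; lia.
have Xw := XF _ Xx.
have big : ~ lexle (tail (F x) (n%:Z - R%:Z)) (suffix_at (m - R) d).
  move=> le; apply: xm.
  pose t := sigma (n%:Z - m%:Z) (F x).
  have Xt : X t by exact: lexshift_sigma.
  have tE (j : int) : t j = F x (j + (n%:Z - m%:Z)) by [].
  (* [y] is 0 0 0 d_0 ... d_(m-R-1) followed by [F x] from [n - R] on. *)
  pose y := glue (m%:Z - R%:Z) (dpoint 0) t.
  have yd k : (k + R < m)%N -> tail y 0 k = d k.
    move=> km; rewrite /tail /digit /y glue_lt; last lia.
    exact: (@digit_dpoint_ge 0 _ k).
  have Xy : X y.
    apply: lexshift_glue => //; first exact: lexshift_dpoint.
    move=> k hk; have [km|mk] := leqP k (m - R); last first.
      have := hk 0%N _; rewrite digit_dpoint ifT; last lia.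
      by move=> /(_ ltac:(lia)) d0; have := d0_gt0; rewrite -d0.
    apply: (@lexle_trans (suffix_at (m - R) d)).
      apply: lexle_eq le => // i; rewrite /tail /digit tE; congr (val (F x _)); lia.
    apply: lexle_eq (lexle_suffix (k := k) _ (@d_max (m - R - k)%N)) => // i.
      by rewrite /suffix_at; congr d; lia.
    move=> ik; rewrite /suffix_at -(hk _ ik).
    by apply/esym; apply: digit_dpoint_ge; lia.
  have yt (j : int) : m%:Z - (3 * R)%:Z <= j -> y j = t j.
    move=> jm; have [jR|Rj] := ltP j (m%:Z - R%:Z); last by rewrite /y glue_ge.
    apply: digit_inj.
    have [k [jE k0 kR]] : exists k, [/\ j = m%:Z - k%:Z, (R < k)%N & (k <= 3 * R)%N].
      by exists `|(m%:Z - j)%R|%N; split; lia.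
    transitivity (d (m - k)%N).
      by rewrite -yd; [rewrite /tail; congr digit; lia|lia].
    rewrite -past' -?wn; [|lia..].
    by rewrite /tail /digit tE; congr (val (F x _)); lia.
  have gt (j : int) : m%:Z - R%:Z - R%:Z <= j -> G y j = x (j + (n%:Z - m%:Z)).
    move=> jm; have -> : x (j + (n%:Z - m%:Z)) = G t j by rewrite sG // GF.
    by apply: lG => // l lj; apply: yt; lia.
  have gd k : (k < m)%N -> tail (G y) 0 k = d k.
    move=> km; have [kR|Rk] := ltnP (k + (R + R)) m.
      by apply: (h2 (m - R)%N) => //; [lia|move=> l lm; apply: yd; lia|lia].
    rewrite /tail /digit gt; last lia.
    have -> : k = (m - (m - k))%N by lia.
    rewrite -past'; [|lia..].
    by rewrite -xn; [rewrite /tail /digit; congr (val (x _)); lia|lia].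
  apply: lexle_eq (lexle_suffix (k := m) gd (XG _ Xy 0)) => // i.
  by rewrite /suffix_at /tail /digit gt; [congr (val (x _)); lia|lia].
have /not_lexle[q e lt] := big.
(* A first difference before [n] would make [F x] larger than [d], since the tails
   of [d] at [n - R] and [m - R] have their first [R] letters in common. *)
have Rq : (R <= q)%N.
  rewrite leqNgt; apply/negP => qR.
  have E (i : nat) : tail (F x) (n%:Z - R%:Z) i = tail (F x) 0 (n - R + i).
    by rewrite /tail; congr digit; lia.
  have dE (i : nat) : (i < R)%N -> suffix_at (m - R) d i = d (n - R + i)%N.
    move=> iR; rewrite /suffix_at.
    have := past' (R - i)%N; rewrite (_ : (n - (R - i) = n - R + i)%N); last lia.
    by rewrite (_ : (m - (R - i) = m - R + i)%N); [move=> ->; lia|lia].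
  have := Xw 0 (n - R + q)%N; rewrite -E => h.
  suff : (tail (F x) (n%:Z - R%:Z) q <= d (n - R + q))%N.
    by rewrite leqNgt -dE // lt.
  apply: h => i iq; have [iR|Ri] := ltnP (i + R) n; first exact: wn.
  have -> : i = (n - R + (i - (n - R)))%N by lia.
  by rewrite -E e; [rewrite dE //; lia|lia].
split=> //.
- move=> k kn; have [kR|Rk] := ltnP (k + R) n; first exact: wn.
  have := e (k - (n - R))%N; rewrite /tail /suffix_at => h.
  have -> : 0 + k%:Z = n%:Z - R%:Z + (k - (n - R))%N%:Z by lia.
  rewrite h; last lia.
  have := past' (n - k)%N; rewrite (_ : (n - (n - k) = k)%N); last lia.
  by rewrite (_ : (m - (n - k) = m - R + (k - (n - R)))%N); [move=> ->; lia|lia].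
- have E k : tail (F x) n%:Z k = tail (F x) (n%:Z - R%:Z) (R + k).
    by rewrite /tail; congr digit; lia.
  move=> /(_ (q - R)%N); rewrite E subnKC // leqNgt.
  rewrite (_ : suffix_at m d _ = suffix_at (m - R) d q); last first.
    by rewrite /suffix_at; congr d; lia.
  rewrite lt => h; have : false; last by [].
  apply: h => i iq; rewrite E e; last lia.
  by rewrite /suffix_at; congr d; lia.
Qed.

Lemma trapping_word r : exists2 n, (r < n)%N &
  forall x, X x -> (forall k, (k <= n)%N -> tail x 0 k = d k) ->
  forall s k, (k < n)%N -> tail (iter s F x) 0 k = d k.
Proof.
have [N stable] := trapped_stable.
have [n [m [Nn Nm past lt]]] := right_special_factor (3 * R) (N + r.+1).
exists (n + 3 * R)%N; first lia.
move=> x Xx xd s.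
suff : trapped (n + 3 * R) (m + 3 * R) (iter s F x) by case.
elim: s => [|s IH] /=; last first.
  apply: stable IH; [lia|lia|].
  by move=> i iR; rewrite !addnK; exact: past.
split=> //; first by move=> k kn; apply: xd; lia.
move=> /(_ 0%N); rewrite /suffix_at addn0 leqNgt.
rewrite (_ : tail x _ 0 = d (n + 3 * R)%N); last first.
  by rewrite -xd // /tail; congr digit; lia.
by rewrite lt => h; have : false by exact: h.
Qed.

Lemma trapped_admits_blocking_word : subshift X -> admits_blocking_word X F.
Proof.
move=> sX; have [_ sF lF _] := hF.
split; first by exists R; exact: (local_radius ord0 sX sF lF).
move=> r _; have [n rn trap] := trapping_word r.
exists (word (dpoint 0) 0 n.+1); split.
  by exists (dpoint 0), 0; split; [exact: lexshift_dpoint|rewrite size_word].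
exists n, 0%N; rewrite size_word; split; [lia|lia|].
have read x : word x 0 n.+1 = word (dpoint 0) 0 n.+1 ->
    forall k, (k <= n)%N -> tail x 0 k = d k.
  move=> e k kn; have := congr1 (fun w => val (nth ord0 w k : A)) e.
  by rewrite !nth_mkseq // => xk; rewrite -[RHS](@tail_dpoint 0); exact: xk.
move=> x y Xx Xy /read xd /read yd s; apply/eq_in_map => k.
rewrite mem_iota add0n => /andP[_ kn]; apply: digit_inj.
by rewrite -!/(tail _ _ k) !trap.
Qed.

End MainArgument.
End LexShift.

(** * The sequence d(beta) and the language of the beta-shift *)
Section Beta.
Variables (R : realType) (beta : R).
Hypothesis beta_gt1 : 1 < beta.
Local Notation d := (dbeta beta).
Local Notation A := (beta_letter beta).

(** [iter k T 1 <= 1], and [T] preserves this inequality of orbits as long as the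
    digits are equal. *)
Lemma dbeta_max k : lexle (suffix_at k d) d.
Proof.
have beta0 : 0 < beta by exact: lt_trans beta_gt1.
have pos i : 0 <= beta * iter i (Tbeta beta) 1.
  by apply: mulr_ge0; [exact: ltW|case/andP: (iter_Tbeta_itv beta i)].
move=> n e; apply: le_truncn; rewrite ler_pM2l //.
elim: n e => [|n IH] e.
  by rewrite addn0; case/andP: (iter_Tbeta_itv beta k).
have le := IH (fun i h => e i (ltnW h)).
have flE i : Num.floor (beta * iter i (Tbeta beta) 1) = (d i)%:Z.
  by rewrite /dbeta truncn_floor pos gez0_abs // floor_ge0.
rewrite addnS !iterS /Tbeta !flE.
by have := e n (ltnSn n); rewrite /suffix_at => ->; rewrite lerD2r ler_pM2l.
Qed.

(** A tail that starts inside a block [d_0 ... d_(m-1) b] is compared with [d] no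
    later than at [b], where it is strictly smaller since
    [b < d m <= d (m - i)]. *)
Lemma concat_lexle (us : seq (seq nat)) : (forall u, u \in us -> Ybeta beta u) ->
  forall i n, (i + n < size (flatten us))%N ->
    (forall j, (j < n)%N -> nth 0%N (flatten us) (i + j) = d j) ->
    (nth 0%N (flatten us) (i + n) <= d n)%N.
Proof.
elim: us => [//|u us IH] Yus i n.
have {}IH := IH (fun v h => Yus v (mem_behead (s := u :: us) h)).
have [m [b [lt_b ->]]] := Yus u (mem_head u us).
rewrite /= cat_rcons.
have dE j : (j < m)%N -> nth 0%N (mkseq d m ++ b :: flatten us) j = d j.
  by move=> jm; rewrite nth_cat size_mkseq jm nth_mkseq.
have bE : nth 0%N (mkseq d m ++ b :: flatten us) m = b.
  by rewrite nth_cat size_mkseq ltnn subnn.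
have vE j : nth 0%N (mkseq d m ++ b :: flatten us) (m.+1 + j) = nth 0%N (flatten us) j.
  by rewrite nth_cat size_mkseq ifF ?addSn ?subSn ?leq_addr ?addKn //; lia.
rewrite size_cat size_mkseq /= => sz e.
have [mi|im] := ltnP m i.
  have iE : i = (m.+1 + (i - m.+1))%N by lia.
  rewrite iE -addnA vE; apply: IH; first lia.
  by move=> j jn; rewrite -e // -vE; congr nth; lia.
have before l : (l <= m - i)%N -> (l <= n)%N -> forall j, (j < l)%N -> suffix_at i d j = d j.
  by move=> lm ln j jl; rewrite /suffix_at -(e j) ?dE //; lia.
have [nm|] := ltnP n (m - i).
  by rewrite dE; [apply: (dbeta_max (k := i)); apply: before; lia|lia].
(* Once the block has been read from [i] to [m - 1], maximality of [d] bounds [d m]. *)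
have dmi : (m - i <= n)%N -> (d m <= d (m - i))%N.
  move=> h; have := @dbeta_max i (m - i)%N; rewrite /suffix_at subnKC //; apply.
  by apply: before.
rewrite leq_eqVlt => /orP[/eqP nE|mn].
  by rewrite -nE subnKC // bE; apply: leq_trans (ltnW lt_b) _; apply: dmi; lia.
have := e _ mn; rewrite subnKC // bE => bd.
by have := dmi (ltnW mn); rewrite -bd leqNgt lt_b.
Qed.

(** Greedy parsing: cut after the first letter that differs from [d]. The
    hypothesis on the nonzero digits completes a last block that is only a prefix
    of [d]. *)
Lemma lexle_concat (w : seq nat) : (forall k, exists2 m, (k <= m)%N & (0 < d m)%N) ->
  (forall i n, (i + n < size w)%N ->
    (forall j, (j < n)%N -> nth 0%N w (i + j) = d j) ->
    (nth 0%N w (i + n) <= d n)%N) ->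
  exists2 us, (forall u, u \in us -> Ybeta beta u) & prefix w (flatten us).
Proof.
move=> alive; have [l] := ubnP (size w); elim: l w => // l IH w wl wle.
have [eq_w|/existsNP[n0 /not_implyP[n0w /eqP n0d]]] :=
    pselect (forall n, (n < size w)%N -> nth 0%N w n = d n).
  have [m wm dm] := alive (size w).
  exists [:: rcons (mkseq d m) 0%N].
    by move=> u; rewrite inE => /eqP->; exists m, 0%N.
  rewrite /= cats0 -cats1 -(subnKC wm) /mkseq iotaD map_cat -catA.
  rewrite (_ : map _ _ = w) ?prefix_prefix //.
  apply: (@eq_from_nth _ 0%N); rewrite size_map size_iota // => i iw.
  by rewrite (nth_map 0%N) ?size_iota // nth_iota // eq_w.
have exn : exists n, (n < size w)%N && (nth 0%N w n != d n).
  by exists n0; rewrite n0w.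
case: (ex_minnP exn) => n /andP[nw nd] nmin.
have eq_n j : (j < n)%N -> nth 0%N w j = d j.
  move=> jn; apply/eqP/negPn/negP => h.
  have : (n <= j)%N by apply: nmin; rewrite h andbT; lia.
  by rewrite leqNgt jn.
have lt_n : (nth 0%N w n < d n)%N.
  by rewrite ltn_neqAle nd; apply: (wle 0%N n).
have [||us Yus wus] := IH (drop n.+1 w).
- rewrite size_drop; lia.
- move=> i k; rewrite size_drop => ik e; rewrite nth_drop addnA; apply: wle.
    lia.
  by move=> j jk; rewrite -e // nth_drop addnA.
exists (rcons (mkseq d n) (nth 0%N w n) :: us).
  by move=> u; rewrite inE => /orP[/eqP->|/Yus//]; exists n, (nth 0%N w n).
have -> : w = rcons (mkseq d n) (nth 0%N w n) ++ drop n.+1 w.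
  rewrite -[LHS](cat_take_drop n.+1); congr (_ ++ _).
  rewrite (take_nth 0%N) //; congr rcons.
  apply: (@eq_from_nth _ 0%N); first by rewrite size_mkseq size_takel // ltnW.
  move=> j; rewrite size_takel; last exact: ltnW.
  by move=> jn; rewrite nth_take // nth_mkseq // eq_n.
rewrite /= (_ : nth 0%N (_ ++ _) n = nth 0%N w n).
  by case/prefixP: wus => v ->; rewrite catA prefix_prefix.
by rewrite nth_cat size_rcons size_mkseq ltnSn nth_rcons size_mkseq ltnn eqxx.
Qed.

Lemma beta_shift_lexle :
  (forall n p, (0 < p)%N -> exists k, d (n + k)%N <> d (n + p + k)%N) ->
  beta_shift beta = @lexshift (Num.truncn beta) d.
Proof.
move=> aper.
have alive k : exists2 m, (k <= m)%N & (0 < d m)%N.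
  apply: contrapT => none; have [l] := @aper k 1%N isT; apply.
  have d0 j : d (k + j)%N = 0%N.
    apply/eqP; rewrite -leqn0 leqNgt; apply/negP => h; apply: none.
    by exists (k + j)%N => //; exact: leq_addr.
  by rewrite d0 -addnA d0.
have nthE (x : conf A) (i : int) n k : (k < n)%N ->
    nth 0%N (letters (word x i n)) k = digit (x : conf 'I_(Num.truncn beta).+1) (i + k%:Z).
  by move=> kn; rewrite (nth_map ord0) ?size_word // nth_mkseq.
apply/seteqP; split=> x.
  move=> Sx i n e; have [us [Yus /infixP[p [s def]]]] := Sx i n.+1.
  have E k : (k <= n)%N -> nth 0%N (flatten us) (size p + k) = tail x i k.
    move=> kn; rewrite def nth_cat ifF; last by rewrite ltnNge leq_addr.
    by rewrite addKn nth_cat size_map size_word ltnS kn nthE.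
  rewrite -E //; apply: concat_lexle => //.
    by rewrite def !size_cat size_map size_word ltn_add2l addSn ltnS leq_addr.
  by move=> j jn; rewrite E ?e // ltnW.
move=> Sx i n.
have [|us Yus pre] := @lexle_concat (letters (word x i n)) alive.
  move=> j k; rewrite size_map size_word => jk e.
  have E l : (j + l < n)%N -> nth 0%N (letters (word x i n)) (j + l) = tail x (i + j%:Z) l.
    by move=> h; rewrite nthE // /tail PoszD addrA.
  rewrite E //; apply: Sx => l lk; rewrite -E ?e //; lia.
by exists us; split=> //; exact: prefixW.
Qed.


(** * A sofic presentation when d(beta) is eventually periodic *)
Section EventuallyPeriodic.
Variables (n p : nat).
Hypothesis d_per : forall k, d (n + k)%N = d (n + p.+1 + k)%N.

Local Notation V := ('I_(n + p).+1).
Implicit Types (v t : V) (s : nat).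

(** The states are the positions in [d]; from the last one, the reading of [d]
    resumes at the start [n] of its period. *)
Definition next v : V := if (v < n + p)%N then inord v.+1 else inord n.

(** When [d] ends with zeros, the zeros after the last positive digit never
    occur inside a block of [Ybeta]: a state is useful only if a block can still
    be closed after it. *)
Definition alive v := exists k, (0 < d (v + k)%N)%N.

Definition edge v (b : nat) t :=
  alive t /\ ((b < d v)%N /\ t = ord0 \/ b = d v /\ t = next v).

Fixpoint reads v (w : seq nat) : Prop :=
  if w is b :: w' then exists2 t, edge v b t & reads t w' else True.

Definition represents v s := forall k, d (s + k)%N = d (v + k)%N.

Lemma alive0 : alive ord0.
Proof. by exists 0%N; exact: dbeta0_gt0. Qed.

Lemma represents_next v s : represents v s -> represents (next v) s.+1.
Proof.
move=> vs k; rewrite addSnnS vs -addSnnS /next.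
have := ltn_ord v; case: ifP => vn vlt.
  by rewrite inordK //; lia.
rewrite inordK; last lia.
by rewrite d_per; congr dbeta; lia.
Qed.

Lemma reads_Ybeta v s k b w : represents v s -> (b < d (s + k)%N)%N ->
  reads ord0 w -> reads v (mkseq (suffix_at s d) k ++ b :: w).
Proof.
move=> vs; elim: k => [|k IH] in v s vs *; move=> bd rw.
  exists ord0 => //; split; [exact: alive0|left; split=> //].
  by rewrite -[nat_of_ord v]addn0 -vs.
exists (next v).
  split; last by right; split=> //; rewrite /suffix_at vs addn0.
  by exists k; rewrite -(represents_next vs) addSnnS; exact: leq_ltn_trans bd.
rewrite (_ : map _ _ = mkseq (suffix_at s.+1 d) k).
  by apply: IH => //; [exact: represents_next|rewrite addSnnS].
rewrite /mkseq -[1%N]/(1 + 0)%N iotaDl -map_comp; apply: eq_map => j.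
by rewrite /suffix_at /=; congr dbeta; lia.
Qed.

Lemma reads_flatten (us : seq (seq nat)) :
  (forall u, u \in us -> Ybeta beta u) -> reads ord0 (flatten us).
Proof.
elim: us => //= u us IH Yus.
have [m [b [bd ->]]] := Yus u (mem_head _ _).
rewrite cat_rcons; apply: (@reads_Ybeta _ 0%N) => //.
by apply: IH => w h; apply: Yus; rewrite inE h orbT.
Qed.

Lemma reads_suffix v w1 w2 : reads v (w1 ++ w2) -> exists t, reads t w2.
Proof. by elim: w1 v => [|b w IH] v /=; [exists v|case=> t _ /IH]. Qed.

Lemma reads_prefix v w1 w2 : reads v (w1 ++ w2) -> reads v w1.
Proof. by elim: w1 v => //= b w IH v [t vt /IH]; exists t. Qed.

Lemma reads_states v w : reads v w -> exists2 f : nat -> V, f 0%N = v &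
  forall k, (k < size w)%N -> edge (f k) (nth 0%N w k) (f k.+1).
Proof.
elim: w v => [|b w IH] v /=; first by exists (fun=> v).
case=> t vt /IH[f f0 fP].
exists (fun k => if k is k'.+1 then f k' else v) => // -[_|k kw] /=.
  by rewrite f0.
exact: fP.
Qed.

Lemma states_reads (f : int -> V) (g : int -> nat) :
  (forall i, edge (f i) (g i) (f (i + 1))) ->
  forall m (i : int), reads (f i) (mkseq (fun k => g (i + k%:Z)) m).
Proof.
move=> fg; elim=> [//|m IH] i; exists (f (i + 1)); first by rewrite addr0.
rewrite (_ : map _ _ = mkseq (fun k => g (i + 1 + k%:Z)) m); first exact: IH.
rewrite /mkseq -[1%N]/(1 + 0)%N iotaDl -map_comp; apply: eq_map => j /=.
by congr g; lia.
Qed.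

(** A walk that starts in the middle of [d] is completed on the left by the prefix
    of [d] that leads there, and on the right by closing the last block, which is
    possible from a state that is [alive]. *)
Lemma reads_concat v s w : represents v s -> alive v -> reads v w ->
  exists2 us, (forall u, u \in us -> Ybeta beta u) &
    prefix (mkseq d s ++ w) (flatten us).
Proof.
have split_at k m : (k <= m)%N -> exists r, mkseq d m = mkseq d k ++ r.
  move=> km; exists (map d (iota (0 + k) (m - k))).
  by rewrite -(subnKC km) /mkseq iotaD map_cat; congr (_ ++ map _ _); rewrite subnKC // addKn.
elim: w v s => [|b w IH] v s vs av.
  case: av => k dk _; exists [:: rcons (mkseq d (s + k)) 0%N].
    by move=> u; rewrite inE => /eqP->; exists (s + k)%N, 0%N; rewrite vs.
  have [r ->] := split_at s (s + k)%N (leq_addr _ _).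
  by rewrite /= cats0 rcons_cat cats0 prefix_prefix.
case=> t [at_ [[bd tE]|[bd tE]] rt].
  have t0 : represents t 0 by rewrite tE.
  have [us Yus pre] := IH t 0%N t0 at_ rt.
  exists (rcons (mkseq d s) b :: us).
    move=> u; rewrite inE => /orP[/eqP->|/Yus//]; exists s, b; split=> //.
    by rewrite -[s]addn0 vs addn0.
  by rewrite -cat_rcons /= prefix_catr // eqxx.
have ts : represents t s.+1 by rewrite tE; exact: represents_next.
have [us Yus pre] := IH t s.+1 ts at_ rt.
exists us => //; move: pre; rewrite mkseqS -cats1 -catA /=.
by rewrite bd -[nat_of_ord v]addn0 -vs addn0.
Qed.


(** A point of the beta-shift has walks over all its finite windows; compactness
    of the space of sequences of states provides a bi-infinite one. *)
Lemma eventually_periodic_sofic : sofic (beta_shift beta).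
Proof.
pose E := {e : V * A * V | `[< edge e.1.1 (val e.1.2) e.2 >]}.
pose src (e : E) : V := (val e).1.1.
pose tgt (e : E) : V := (val e).2.
pose lab (e : E) : A := (val e).1.2.
exists V, E, src, tgt, lab; apply/seteqP; split=> x.
  move=> Sx.
  pose C N : set (conf V) := [set f | forall i : int, (- N%:Z <= i < N%:Z) ->
    edge (f i) (val (x i : A)) (f (i + 1))].
  have [|||f fP] := @bigcap_conf _ C.
  - move=> N; apply: closed_cylinder => f fP i iN.
    have [g gP gf] := fP N.+1.
    by rewrite -!gf; [exact: gP|lia|lia].
  - move=> N; have [us [Yus /infixP[w1 [w2 def]]]] := Sx (- N%:Z) (N + N)%N.
    have := reads_flatten Yus; rewrite def => /reads_suffix[v /reads_prefix].
    move=> /reads_states[f _]; rewrite size_map size_word => fP.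
    exists (fun i => f `|(i + N%:Z)%R|%N) => i iN.
    have kN : (`|(i + N%:Z)%R| < N + N)%N by lia.
    have := fP _ kN; rewrite (nth_map ord0) ?size_word // nth_mkseq //.
    rewrite (_ : - N%:Z + _ = i); last lia.
    by rewrite (_ : `|(i + N%:Z)%R|.+1 = `|(i + 1 + N%:Z)%R|)%N //; lia.
  - by move=> N f fP i iN; apply: fP; lia.
  have fE (i : int) : `[< edge (f i) (val (x i : A)) (f (i + 1)) >].
    by apply/asboolP; apply: (fP `|i|.+1); lia.
  by exists (fun i => exist _ (f i, x i, f (i + 1)) (fE i)) => i.
case=> e eP i m.
pose f i := src (e i).
have fE j : edge (f j) (val (lab (e j))) (f (j + 1)).
  by have [+ _] := eP j; rewrite /f => <-; have /asboolP := valP (e j).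
have af : alive (f i) by have [+ _] := fE (i - 1); rewrite subrK.
have fi : represents (f i) (f i) by [].
have [us Yus pre] := reads_concat fi af (states_reads fE m i).
exists us; split=> //; apply/infixP.
have [r ->] := prefixP pre; exists (mkseq d (f i)), r.
rewrite -catA; congr (_ ++ (_ ++ _)).
rewrite /letters /word /mkseq -map_comp; apply: eq_map => k /=.
by have [_ ->] := eP (i + k%:Z).
Qed.

End EventuallyPeriodic.

Lemma nonsofic_aperiodic : ~ sofic (beta_shift beta) ->
  forall n p, (0 < p)%N -> exists k, d (n + k)%N <> d (n + p + k)%N.
Proof.
move=> nsof n [//|p] _; apply: contrapT => per; apply: nsof.
apply: (@eventually_periodic_sofic n p) => k.
by apply: contrapT => ne; apply: per; exists k.
Qed.

End Beta.

Theorem theorem4p3 (R : realType) (beta : R) (hbeta : 1 < beta)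
    (hsofic : ~ sofic (beta_shift beta)) :
  (forall F : conf (beta_letter beta) -> conf (beta_letter beta),
     Aut (beta_shift beta) F -> shiftless F ->
     admits_blocking_word (beta_shift beta) F) /\
  (forall F : conf (beta_letter beta) -> conf (beta_letter beta),
     Aut (beta_shift beta) F ->
     exists (p : int) (q : nat),
       almost_equicontinuous_direction (beta_shift beta) F p q).
Proof.
have aper := nonsofic_aperiodic hbeta hsofic.
have SE := beta_shift_lexle hbeta aper.
have [sX _] := beta_shiftP hbeta.
have d_le := dbeta_le hbeta; have d_max := dbeta_max hbeta.
split=> F AF.
  move=> sl; have [N [G [hF hG]]] := Aut_half_inverse sX AF.
  have Gd : preserves_tail (dbeta beta) G.
    rewrite /preserves_tail -SE => x Xx xd; have [XG _ _ FG] := hG.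
    by apply: (sl x) => //; [exact: XG|exact: FG].
  rewrite SE in hF hG sX *.
  have Fd := preserves_tail_inverse d_le d_max aper hF hG Gd.
  exact: (trapped_admits_blocking_word d_le d_max aper hF hG Fd Gd sX).
have [N [G [hF hG]]] := Aut_half_inverse sX AF.
have sX' := sX; rewrite SE in hF hG sX' *.
have [i iP] := image_tail d_le d_max aper hF hG.
have [hF' hG'] := half_inverse_sigma i sX' hF hG.
have Fd : preserves_tail (dbeta beta) (sigma i \o F).
  move=> x Xx xd k; rewrite -(iP x Xx xd) /tail /digit /sigma /=.
  by congr (val (F x _)); lia.
have Gd := preserves_tail_inverse d_le d_max aper hG' hF' Fd.
exists i, 1%N; split=> //; first by rewrite coprimezE coprimen1.
split.
  by have [XF' sF' lF' _] := hF'; exact: (local_CA XF' sF' lF').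
exact: (trapped_admits_blocking_word d_le d_max aper hF' hG' Fd Gd sX').
Qed.
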